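(* Let $V$ be a finite set and let $R:V\times V\to 2^V$ be a poset function such that for all $u,v,w\in V$, $w\in R(u,v)$ implies $R(u,w)\cup R(w,v)=R(u,v)$. Let $G_R$ be the underlying digraph of $R$ and let $R_{G_R}$ be the path transit function of $G_R$. Then $G_R$ is a mangrove and $R=R_{G_R}$.
   Context: Let $V$ be a finite set. A directed transit function on $V$ is a function $R:V\times V\to 2^V$ satisfying (t0) for all $u,v,w\in V$: if $R(u,w)\neq\emptyset$ and $R(w,v)\neq\emptyset$ then $R(u,v)\neq\emptyset$; (t1) for all $u,v\in V$: if $R(u,v)\neq\emptyset$ then $\{u,v\}\subseteq R(u,v)$; (t3) $R(u,u)=\{u\}$ for all $u\in V$. A poset function is a directed transit function that in addition satisfies (t2a) for all $u,v\in V$: if $R(u,v)\neq\emptyset$ and $u\neq v$ then $R(v,u)=\emptyset$; (tr1) for all $u,v,w\in V$ with $u\neq v$: if $R(u,w)\neq\emptyset$ and $R(w,v)\neq\emptyset$ then $R(u,w)\cup R(w,v)\subseteq R(u,v)$; (tr2) for all $u,v,w\in V$ with $u\neq v$: if $R(u,w)=\emptyset$ or $R(w,v)=\emptyset$ then $w\notin R(u,v)$. The underlying digraph $G_R$ of $R$ has vertex set $V$, and $(x,y)$ is a directed edge of $G_R$ if and only if $x\neq y$ and $R(x,y)=\{x,y\}$. A directed path from $u$ to $v$ is a sequence $(x_0=u,x_1,\dots,x_n=v)$ of pairwise distinct vertices with each $(x_{i-1},x_i)$ an edge; $n=0$ is allowed. For a digraph $G$ with vertex set $V$, the path transit function $R_G$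 is $R_G(u,v)=\{x\in V\mid x \text{ lies on a directed path from } u \text{ to } v \text{ in } G\}$. A mangrove is a directed acyclic graph in which, for any two vertices $u,v$, there is at most one directed path from $u$ to $v$. *)

(* Defs.v *)
From mathcomp Require Import all_boot.

Set Implicit Arguments.
Unset Strict Implicit.
Unset Printing Implicit Defensive.

Record directed_transit (V : finType) (R : V -> V -> {set V}) : Prop :=
  DirectedTransit {
    dt_t0 : forall u v w : V, R u w != set0 -> R w v != set0 -> R u v != set0;
    dt_t1 : forall u v : V, R u v != set0 -> [set u; v] \subset R u v;
    dt_t3 : forall u : V, R u u = [set u] }.

Record poset_function (V : finType) (R : V -> V -> {set V}) : Prop :=
  PosetFunction {
    pf_directed_transit : directed_transit R;
    pf_t2a : forall u v : V, R u v != set0 -> u != v -> R v u = set0;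
    pf_tr1 : forall u v w : V, u != v ->
      R u w != set0 -> R w v != set0 -> R u w :|: R w v \subset R u v;
    pf_tr2 : forall u v w : V, u != v ->
      R u w = set0 \/ R w v = set0 -> w \notin R u v }.

(* A digraph on V is given by its adjacency relation. *)
Definition underlying_digraph (V : finType) (R : V -> V -> {set V}) : rel V :=
  fun x y => (x != y) && (R x y == [set x; y]).

(* As in path.v, the vertex sequence of the path is u :: p; the one-vertex path
   from u to u is p = [::]. *)
Definition dipath (V : finType) (G : rel V) (u v : V) (p : seq V) : bool :=
  [&& path G u p, uniq (u :: p) & last u p == v].

(* A path has pairwise distinct vertices, so bounding the length of its tail p
   by #|V| - 1 loses nothing (path_transitP); it makes the set decidable. *)
Definition path_transit (V : finType) (G : rel V) (u v : V) : {set V} :=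
  [set x | [exists n : 'I_#|V|, [exists p : n.-tuple V,
             dipath G u v p && (x \in u :: p)]]].

Lemma path_transitP (V : finType) (G : rel V) (u v x : V) :
  reflect (exists2 p : seq V, dipath G u v p & x \in u :: p)
          (x \in path_transit G u v).
Proof.
rewrite inE; apply: (iffP existsP) => [[n /existsP[p /andP[Gp px]]]|[p Gp px]].
  by exists p.
have lt_p : size p < #|V|.
  have /and3P[_ /card_uniqP card_p _] := Gp.
  by rewrite -[_ < _]/(size (u :: p) <= _) -card_p max_card.
by exists (Ordinal lt_p); apply/existsP; exists (in_tuple p); rewrite Gp px.
Qed.

(* A directed cycle is a nonempty ucycle; a loop counts as one. *)
Definition acyclic (V : finType) (G : rel V) : Prop :=
  forall c : seq V, ucycle G c -> c = [::].

Definition mangrove (V : finType) (G : rel V) : Prop :=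
  acyclic G /\
  forall (u v : V) (p q : seq V), dipath G u v p -> dipath G u v q -> p = q.

(* Main.v *)
(* The relation [R u v != set0] is a partial order whose intervals are the sets
   R u v, and the edges of the underlying digraph are its covering pairs.  The
   extra hypothesis says that every interval is a chain.  Hence two paths from
   u to v start with the same edge: their second vertices are comparable and
   both cover u.  By finiteness every interval is filled by paths of covers. *)
Require Import Defs.
From mathcomp Require Import all_boot.

Section PosetFunction.

Set Implicit Arguments.
Unset Strict Implicit.

Variables (V : finType) (R : V -> V -> {set V}).
Hypothesis hR : poset_function R.

Let G := underlying_digraph R.

Definition transit_le (x y : V) : bool := R x y != set0.
Definition transit_lt (x y : V) : bool := (x != y) && transit_le x y.

Lemma transit_le_refl : reflexive transit_le.
Proof.
move=> u; rewrite /transit_le (dt_t3 (pf_directed_transit hR)).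
by apply/set0Pn; exists u; rewrite inE.
Qed.

Lemma transit_le_trans : transitive transit_le.
Proof. by move=> w u v; apply: (dt_t0 (pf_directed_transit hR)). Qed.

Lemma transit_le_anti : antisymmetric transit_le.
Proof.
move=> u v /andP[uv vu]; apply/eqP/negPn/negP => neq_uv.
by move: vu; rewrite /transit_le (pf_t2a hR uv neq_uv) eqxx.
Qed.

Lemma transit_lt_trans : transitive transit_lt.
Proof.
move=> w u v /andP[neq_uw uw] /andP[neq_wv wv].
rewrite /transit_lt (transit_le_trans uw wv) andbT.
apply: contra neq_uw => /eqP eq_uv; rewrite -eq_uv in wv.
by rewrite (@transit_le_anti u w) ?uw.
Qed.

Lemma transit_lt_irr : irreflexive transit_lt.
Proof. by move=> u; rewrite /transit_lt eqxx. Qed.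

(** For [u != v], the forward direction is the contrapositive of (tr2); the converse is (tr1), since
    [w \in R u w] by (t1). On the diagonal, (t3) reduces the claim to antisymmetry. *)
Lemma in_transit u v w : (w \in R u v) = transit_le u w && transit_le w v.
Proof.
have [<-|neq_uv] := eqVneq u v.
  rewrite (dt_t3 (pf_directed_transit hR)) inE.
  apply/eqP/idP => [->|]; first by rewrite transit_le_refl.
  by rewrite andbC; apply: transit_le_anti.
apply/idP/idP => [|/andP[uw wv]].
  apply: contraLR; rewrite negb_and !negbK => /orP uwv.
  by apply: (pf_tr2 hR neq_uv); case: uwv => /eqP ->; [left|right].
have /subsetP := pf_tr1 hR neq_uv uw wv; apply.
have /subsetP sub := dt_t1 (pf_directed_transit hR) uw.
by rewrite in_setU sub // !inE eqxx orbT.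
Qed.

Lemma transit_endl u v : transit_le u v -> u \in R u v.
Proof. by move=> uv; rewrite in_transit transit_le_refl. Qed.

Lemma transit_endr u v : transit_le u v -> v \in R u v.
Proof. by move=> uv; rewrite in_transit transit_le_refl andbT. Qed.

Lemma edge_lt : subrel G transit_lt.
Proof.
move=> x y /andP[neq_xy /eqP Rxy]; rewrite /transit_lt neq_xy.
by apply/set0Pn; exists x; rewrite Rxy !inE eqxx.
Qed.

Lemma edge_cover x y z :
  G x y -> transit_le x z -> transit_le z y -> z = x \/ z = y.
Proof.
case/andP=> _ /eqP Rxy xz zy; apply/pred2P.
by have := in_transit x y z; rewrite Rxy !inE xz zy.
Qed.

Lemma path_lt u p : path G u p -> path transit_lt u p.
Proof. exact: (sub_path edge_lt). Qed.

(** Edges are strict order steps, so a walk is strictly increasing and cannot repeat a vertex. Walks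
    can therefore be concatenated freely and still give directed paths. *)
Lemma path_dipath u p : path G u p -> dipath G u (last u p) p.
Proof.
move=> Gp; rewrite /dipath Gp eqxx andbT.
apply: (sorted_uniq transit_lt_trans transit_lt_irr (s := u :: p)).
exact: path_lt Gp.
Qed.

Lemma path_le_last u p x :
  path G u p -> x \in u :: p -> transit_le u x /\ transit_le x (last u p).
Proof.
elim: p u x => [|a p IHp] u x /=.
  by rewrite inE => _ /eqP->; rewrite transit_le_refl.
case/andP=> /edge_lt/andP[_ ua] Gp; rewrite inE => /predU1P[->|xp].
  have [_ al] := IHp a _ Gp (mem_head _ _).
  by split; [apply: transit_le_refl | apply: transit_le_trans ua al].
by have [ax xl] := IHp a x Gp xp; split=> //; apply: transit_le_trans ua ax.
Qed.

(** A cycle through [x] is a walk from [x] back to [x], which would put [x] strictly below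
    itself. *)
Lemma underlying_digraph_acyclic : acyclic G.
Proof.
case=> [//|x c] /andP[/path_lt/(order_path_min transit_lt_trans)].
by rewrite all_rcons transit_lt_irr.
Qed.

(** Strong induction on the size of the interval: unless [u = v] or [(u, v)] is an edge, split at an
    intermediate point and join the two walks. *)
Lemma transit_path u v :
  transit_le u v -> exists2 p, path G u p & last u p = v.
Proof.
have [n] := ubnP #|R u v|; elim: n u v => // n IHn u v ltRn uv.
have [eq_uv|neq_uv] := eqVneq u v; first by exists [::].
have [Guv|] := boolP (G u v); first by exists [:: v]; rewrite //= Guv.
(* By (t1) both ends lie in [R u v], so a non-edge must have a third point [w] in its interval. *)
rewrite /G /underlying_digraph neq_uv /= eqEsubset.
rewrite (dt_t1 (pf_directed_transit hR) uv) andbT.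
case/subsetPn=> w; rewrite in_transit => /andP[uw wv].
rewrite !inE negb_or => /andP[neq_wu neq_wv].
have ltn_sub x y : R x y \proper R u v -> #|R x y| < n.
  by move/proper_card=> lt_xy; apply: leq_trans lt_xy _.
have [|p Gp lp] := IHn u w _ uw.
  apply/ltn_sub/properP; split.
    apply/subsetP=> z; rewrite !in_transit => /andP[-> zw].
    exact: transit_le_trans zw wv.
  (* The interval from [u] to [w] misses [v], since [v] below [w] would force [w = v]. Dually, the
     interval from [w] to [v] misses [u]. *)
  exists v; rewrite ?transit_endr // in_transit uv /=.
  by apply: contra neq_wv => vw; rewrite (@transit_le_anti w v) ?wv.
have [|q Gq lq] := IHn w v _ wv.
  apply/ltn_sub/properP; split.
    apply/subsetP=> z; rewrite !in_transit => /andP[wz ->].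
    by rewrite (transit_le_trans uw wz).
  exists u; rewrite ?transit_endl // in_transit uv andbT.
  by apply: contra neq_wu => wu; rewrite (@transit_le_anti w u) ?wu.
by exists (p ++ q); rewrite ?cat_path ?last_cat lp // Gp.
Qed.

Lemma path_transit_underlying u v : R u v = path_transit G u v.
Proof.
apply/setP=> x; rewrite in_transit; apply/andP/path_transitP.
  case=> /transit_path[p Gp lp] /transit_path[q Gq lq].
  have Gpq : path G u (p ++ q) by rewrite cat_path Gp lp.
  exists (p ++ q); first by have := path_dipath Gpq; rewrite last_cat lp lq.
  by rewrite -cat_cons mem_cat -lp mem_last.
by case=> p /and3P[Gp _ /eqP <-] /(path_le_last Gp).
Qed.

Hypothesis hU : forall u v w : V, w \in R u v -> R u w :|: R w v = R u v.

(** Splitting [R u v] at [a] by [hU] puts [b] either in [R u a] or in [R a v]. *)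
Lemma transit_chain u v a b :
  a \in R u v -> b \in R u v -> transit_le a b \/ transit_le b a.
Proof.
move=> auv /[dup] buv; rewrite -(hU auv) inE !in_transit.
by case/orP=> /andP[]; [right|left].
Qed.

(** This rules out, in the uniqueness proof, that exactly one of the two paths is empty. *)
Lemma path_last_neq u a p : path G u (a :: p) -> u != last u (a :: p).
Proof.
move/path_lt/(order_path_min transit_lt_trans)/allP/(_ _ (mem_last _ _)).
by case/andP.
Qed.

Lemma path_unique u p q :
  path G u p -> path G u q -> last u p = last u q -> p = q.
Proof.
elim: p u q => [|a p IHp] u [|b q] //.
- by move=> _ /path_last_neq /[swap] <-; rewrite eqxx.
- by move=> /path_last_neq /[swap] _ /[swap] ->; rewrite eqxx.
move=> Gap Gbq eq_last.
have aR : a \in R u (last u (a :: p)).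
  by rewrite in_transit; apply/andP/(path_le_last Gap); rewrite !inE eqxx orbT.
have bR : b \in R u (last u (a :: p)).
  rewrite in_transit eq_last.
  by apply/andP/(path_le_last Gbq); rewrite !inE eqxx orbT.
have /andP[Gua Gp] := Gap; have /andP[Gub Gq] := Gbq.
have /andP[neq_ua ua] := edge_lt Gua; have /andP[neq_ub ub] := edge_lt Gub.
(* The smaller of [a] and [b] lies between [u] and the other one, which covers [u]; being distinct
   from [u], it equals the other. *)
have eq_ab : a = b.
  case: (transit_chain aR bR) => [ab|ba].
    case: (edge_cover Gub ua ab) => // eq_au.
    by rewrite eq_au eqxx in neq_ua.
  case: (edge_cover Gua ub ba) => // eq_bu.
  by rewrite eq_bu eqxx in neq_ub.
rewrite -{}eq_ab in Gq eq_last *; congr (_ :: _).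
exact: IHp Gp Gq eq_last.
Qed.

End PosetFunction.

Theorem corollary20 (V : finType) (R : V -> V -> {set V})
    (hR : poset_function R)
    (hU : forall u v w : V, w \in R u v -> R u w :|: R w v = R u v) :
  mangrove (underlying_digraph R) /\
  (forall u v : V, R u v = path_transit (underlying_digraph R) u v).
Proof.
split; last exact: path_transit_underlying.
split=> [|u v p q /and3P[Gp _ /eqP lp] /and3P[Gq _ /eqP lq]].
  exact: underlying_digraph_acyclic.
by apply: (path_unique hR hU Gp Gq); rewrite lp lq.
Qed.
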